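(* Let $n$ be a positive integer and let $k\ge 3$ be an integer. If $F_n\equiv 1\pmod k$ and $F_{n+1}\equiv 0\pmod k$, then neither of the equations $$F_nx+F_{n+1}y=\frac{(F_n-1)(F_{n+1}-1)}{k}\quad\text{and}\quad 1+F_nx+F_{n+1}y=\frac{(F_n-1)(F_{n+1}-1)}{k}$$ has a solution in nonnegative integers $x,y$.
   Context: $(F_n)$ is the Fibonacci sequence with $F_1=F_2=1$ and $F_n=F_{n-1}+F_{n-2}$ for all $n\in\mathbb{Z}$. *)

(* Defs.v *)
From mathcomp Require Import all_boot all_order all_algebra.
From mathcomp Require Import zify ring.

Set Implicit Arguments.
Unset Strict Implicit.
Unset Printing Implicit Defensive.

Import Order.TTheory GRing.Theory Num.Theory.

Local Open Scope ring_scope.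

Fixpoint fib_nat (n : nat) : nat :=
  match n with
  | 0 => 0
  | 1 => 1
  | (m.+1 as p).+1 => (fib_nat p + fib_nat m)%N
  end.

(* [Negz m] is the integer -(m+1), and F_(-(m+1)) = (-1)^m F_(m+1);
   [fib1], [fib2] and [fib_rec] below characterize this two-sided sequence. *)
Definition fib (n : int) : int :=
  match n with
  | Posz m => (fib_nat m)%:Z
  | Negz m => (-1) ^+ m * (fib_nat m.+1)%:Z
  end.

Lemma fib1 : fib 1 = 1. Proof. by []. Qed.

Lemma fib2 : fib 2 = 1. Proof. by []. Qed.

Lemma fib_natSS m : fib_nat m.+2 = (fib_nat m.+1 + fib_nat m)%N.
Proof. by []. Qed.

Lemma fib_rec (n : int) : fib n = fib (n - 1) + fib (n - 2).
Proof.
case: n => [[|[|m]]|m] //.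
- have -> : m.+2%:Z - 1 = m.+1 by lia.
  have -> : m.+2%:Z - 2 = m by lia.
  by rewrite /fib fib_natSS PoszD.
- have -> : Negz m - 1 = Negz m.+1 by lia.
  have -> : Negz m - 2 = Negz m.+2 by lia.
  rewrite /fib !exprS (fib_natSS m.+1) (PoszD (fib_nat m.+2)).
  ring.
Qed.

(* Main.v *)
Require Import Defs.
From mathcomp Require Import all_boot all_order all_algebra.
From mathcomp Require Import zify ring.

Import Order.TTheory GRing.Theory Num.Theory.

Local Open Scope ring_scope.

(** Write [a] and [b] for [F_n] and [F_(n+1)], with [a = 1 + k u] and
    [b = k v], so that [(a - 1)(b - 1)/k = u (b - 1)].  Cassini's identity gives
    [a^2 + a b - b^2 = 1] or [-1]; modulo [k] the left-hand side is [1], so the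
    sign is [+] because [k >= 3].  Hence [a] is its own inverse modulo [b], and
    multiplying [c + a x + b y = u (b - 1)] by [a] yields
    [x = u + v - c a (mod b)] ([mul_inverse_residue]).  For [c = 0] the number
    [u + v] lies in [[0, b)], so [x >= u + v]; for [c = 1] the bound [b <= 2 a]
    makes [u + v - a] negative, so [x >= u + v - a + b].  In both cases [a x]
    alone already exceeds [u (b - 1) - c]. *)

Lemma fib_nat_gt0 m : (0 < fib_nat m.+1)%N.
Proof. by elim: m => // m IH; rewrite fib_natSS addn_gt0 IH. Qed.

Lemma fib_nat_leS m : (fib_nat m.+1 <= fib_nat m.+2)%N.
Proof. by rewrite fib_natSS leq_addr. Qed.

Lemma fib_nat_leS_double m : (fib_nat m.+2 <= 2 * fib_nat m.+1)%N.
Proof.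
rewrite fib_natSS mul2n -addnn leq_add2l.
by case: m => // m; apply: fib_nat_leS.
Qed.

(** Cassini's identity, stated with two consecutive terms only. *)
Lemma fib_nat_cassini m (a := (fib_nat m.+1)%:Z) (b := (fib_nat m.+2)%:Z) :
  a ^+ 2 + a * b - b ^+ 2 = (-1) ^+ m.
Proof.
rewrite {}/a {}/b; elim: m => // m IH.
by rewrite [RHS]exprS -IH (fib_natSS m.+1) PoszD; ring.
Qed.

(** Modulo [b = k v] the number [a = 1 + k u] is its own inverse and
    [- u a] is congruent to [u + v]; this determines the class of [x]. *)
Lemma mul_inverse_residue (k u v a b c x y : int) :
  k != 0 -> a = 1 + k * u -> b = k * v -> a ^+ 2 + a * b - b ^+ 2 = 1 ->
  c + a * x + b * y = u * (b - 1) ->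
  exists t, x = u + v - c * a + b * t.
Proof.
move=> k0 ea eb cas eqn.
(* Cassini's identity divided by [k] *)
have quo : 2 * u + k * u ^+ 2 + v + k * u * v - k * v ^+ 2 = 0.
  apply: (mulfI k0); rewrite mulr0.
  transitivity (a ^+ 2 + a * b - b ^+ 2 - 1); last by rewrite cas subrr.
  by rewrite ea eb; ring.
exists (u * a - a * y + a * x - b * x + u - v).
have ua : u * a + u + v + b * (u - v) = 0 by rewrite ea eb -quo; ring.
apply: subr0_eq.
transitivity ((1 - (a ^+ 2 + a * b - b ^+ 2)) * x
              + a * ((c + a * x + b * y) - u * (b - 1))
              - (u * a + u + v + b * (u - v))); first by ring.
by rewrite cas eqn ua !subrr mul0r mulr0 addr0 subr0.
Qed.

Lemma linear_form_neq (k u v a b x y : int) :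
  3 <= k -> a = 1 + k * u -> b = k * v -> a ^+ 2 + a * b - b ^+ 2 = 1 ->
  0 < a <= b -> 0 <= x -> 0 <= y -> a * x + b * y <> u * (b - 1).
Proof.
move=> k3 ea eb cas /andP[a0 ab] x0 y0 eqn.
have k0 : k != 0 by lia.
have [t xE] : exists t, x = u + v - 0 * a + b * t.
  by apply: (@mul_inverse_residue k u v a b 0 x y); rewrite // add0r.
have kp : 0 < k by lia.
have v0 : 0 < v by rewrite -(pmulr_rgt0 v kp); lia.
have uv : u <= v by rewrite -(ler_pM2l kp); lia.
have uvb : u + v < b.
  have : 3 * v <= k * v by rewrite ler_pM2r.
  lia.
have t0 : 0 <= t.
  rewrite leNgt; apply/negP => tn.
  have : b * t <= b * (- 1) by rewrite ler_pM2l; lia.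
  lia.
have xge : u + v <= x.
  have : 0 <= b * t by rewrite mulr_ge0 //; lia.
  lia.
have axle : a * (u + v) <= u * (b - 1).
  have : a * (u + v) <= a * x by rewrite ler_pM2l.
  have : 0 <= b * y by rewrite mulr_ge0 //; lia.
  lia.
(* multiplied by [k], the bound [axle] becomes [a^2 + b <= 1] *)
have : k * (a * (u + v)) <= k * (u * (b - 1)) by rewrite ler_pM2l //; lia.
have -> : k * (a * (u + v)) = a * (a - 1 + b) by rewrite ea eb; ring.
have -> : k * (u * (b - 1)) = (a - 1) * (b - 1) by rewrite ea; ring.
have : 0 < a * a by rewrite mulr_gt0.
lia.
Qed.

Lemma linear_form_succ_neq (k u v a b x y : int) :
  3 <= k -> a = 1 + k * u -> b = k * v -> a ^+ 2 + a * b - b ^+ 2 = 1 ->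
  0 < a -> a <= b <= 2 * a -> 0 <= x -> 0 <= y ->
  1 + a * x + b * y <> u * (b - 1).
Proof.
move=> k3 ea eb cas a0 /andP[ab b2a] x0 y0 eqn.
have k0 : k != 0 by lia.
have [t xE] := @mul_inverse_residue k u v a b 1 x y k0 ea eb cas eqn.
rewrite mul1r in xE.
have kp : 0 < k by lia.
have u0 : 0 <= u by rewrite -(pmulr_rge0 u kp); lia.
have v2u : v <= 2 * u.
  rewrite leNgt; apply/negP => v2u.
  have : k * (2 * u + 1) <= k * v by rewrite ler_pM2l //; lia.
  lia.
have uva : u + v < a.
  have : 3 * u <= k * u by rewrite ler_wpM2r.
  lia.
have t0 : 0 < t.
  rewrite ltNge; apply/negP => tn.
  have : b * t <= 0 by rewrite mulr_ge0_le0 //; lia.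
  lia.
have xge : u + v - a + b <= x.
  have : b * 1 <= b * t by rewrite ler_pM2l; lia.
  lia.
have axle : a * (u + v - a + b) <= u * (b - 1) - 1.
  have : a * (u + v - a + b) <= a * x by rewrite ler_pM2l.
  have : 0 <= b * y by rewrite mulr_ge0 //; lia.
  lia.
(* multiplied by [k], [axle] becomes [a^2 + b - 1 + k + k a (b - a) <= 0] *)
have : k * (a * (u + v - a + b)) <= k * (u * (b - 1) - 1).
  by rewrite ler_pM2l //; lia.
have -> : k * (a * (u + v - a + b)) = a * (a - 1 + b) + k * (a * (b - a)).
  by rewrite ea eb; ring.
have -> : k * (u * (b - 1) - 1) = (a - 1) * (b - 1) - k by rewrite ea; ring.
have : 0 <= k * (a * (b - a)) by rewrite !mulr_ge0 //; lia.
have : 0 < a * a by rewrite mulr_gt0.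
lia.
Qed.

Theorem proposition3p6 :
  forall n k : int, 0 < n -> 3 <= k ->
  (fib n = 1 %[mod k])%Z -> (fib (n + 1) = 0 %[mod k])%Z ->
  ~ (exists x y : int, [/\ 0 <= x, 0 <= y &
       (fib n * x + fib (n + 1) * y)%:Q
         = ((fib n - 1) * (fib (n + 1) - 1))%:Q / k%:Q])
  /\
  ~ (exists x y : int, [/\ 0 <= x, 0 <= y &
       (1 + fib n * x + fib (n + 1) * y)%:Q
         = ((fib n - 1) * (fib (n + 1) - 1))%:Q / k%:Q]).
Proof.
case=> [[|m]|m] k // _ k3.
have -> : m.+1%:Z + 1 = m.+2 by lia.
rewrite /fib; set a := (fib_nat m.+1)%:Z; set b := (fib_nat m.+2)%:Z.
move=> /eqP; rewrite eqz_mod_dvd => /dvdzP[u au].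
move=> /eqP; rewrite eqz_mod_dvd subr0 => /dvdzP[v bv].
have ea : a = 1 + k * u by rewrite mulrC -au; ring.
have eb : b = k * v by rewrite mulrC.
have a0 : 0 < a by rewrite ltz_nat fib_nat_gt0.
have ab : a <= b by rewrite lez_nat fib_nat_leS.
have b2a : b <= 2 * a by rewrite /a /b -PoszM lez_nat fib_nat_leS_double.
have cas : a ^+ 2 + a * b - b ^+ 2 = 1.
  have := fib_nat_cassini m; rewrite -/a -/b -signr_odd.
  case: (odd m) => //; rewrite expr1 => cas.
  (* the sign -1 would make [k] a divisor of 2 *)
  have kw : k * (2 * u + k * u ^+ 2 + v + k * u * v - k * v ^+ 2) = - 2.
    transitivity (a ^+ 2 + a * b - b ^+ 2 - 1); last by rewrite cas.
    by rewrite ea eb; ring.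
  have : (k %| (- 2)%R)%Z by rewrite -kw dvdz_mulr.
  by rewrite dvdzE => /dvdn_leq; lia.
have clear_den z : z%:Q = ((a - 1) * (b - 1))%:Q / k%:Q -> z = u * (b - 1).
  have kQ : k%:Q != 0 by rewrite intr_eq0; lia.
  have -> : (a - 1) * (b - 1) = u * (b - 1) * k by rewrite au; ring.
  by rewrite (intrM _ _ k) mulfK // => /intr_inj.
split=> [] [x [y [x0 y0 /clear_den]]].
- by apply: (@linear_form_neq k u v a b x y) => //; rewrite a0 ab.
- by apply: (@linear_form_succ_neq k u v a b x y) => //; rewrite ab b2a.
Qed.
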